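(* In the elliptic plane, let $$\mathcal{C}\colon b x_1^2+a x_2^2=x_0^2,\qquad a,b\in\mathbb{R}\setminus\{0\}.$$ The Frégier conic to $\mathcal{C}$ is singular if and only if $a$ and $b$ satisfy one of $$b^2=\frac{a^2}{a^2+1},\qquad b^2=\frac{-a^2}{a^2-1},\qquad\text{or}\qquad b^2=-\frac{a^2}{a^2+1}.$$ The last case is never real, and none of these families contains real circles.
   Context: Points have homogeneous coordinates $[x_0,x_1,x_2]$, and the absolute conic of the elliptic plane is $\mathcal{N}\colon x_0^2+x_1^2+x_2^2=0$. Two lines are orthogonal if they are conjugate with respect to $\mathcal{N}$. A circle is a conic having double contact with $\mathcal{N}$, i.e. the four (complex) base points of the pencil spanned by the conic and $\mathcal{N}$ form precisely two pairs of coinciding points. For a regular conic $\mathcal{C}$ and $p\in\mathcal{C}$, the Frégier point $f(\mathcal{C},p)$ is the point common to the hypotenuses of all right triangles inscribed into $\mathcal{C}$ with right angle at $p$; equivalently, it is the pole with respect to $\mathcal{C}$ of the line $i\vee\overline{i}$, where $i$ and $\overline{i}$ are the projections of $p$ onto $\mathcal{C}$ via the isotropic lines through $p$ (the complex tangents of $\mathcal{N}$ through $p$). The Frégier conic (Frégier locus) of $\mathcal{C}$ is $\mathcal{F}=\{f(\mathcal{C},p)\mid p\in\mathcal{C}\}$; it is called singular if it is not a regular conic.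
   Formalization: The conic is taken as b^2 x_1^2 + a^2 x_2^2 = a^2 b^2 x_0^2, not b x_1^2 + a x_2^2 = x_0^2; with the printed equation the claim is false: a=2, b=3 has collinear Frégier points [6p_0,-2p_1,0], but b^2=9 is in none of the three families. *)

(* Defs.v *)
(* Points of the real projective plane are nonzero row vectors of R^3 up to a
   nonzero factor; two of them are the same point iff they span the same row
   space, (x == y)%MS.  Lines are nonzero row vectors as well: u stands for the
   line of all x with x *m u^T = 0.  A conic is given by its symmetric matrix. *)

From mathcomp Require Import all_boot all_order all_algebra.
From mathcomp Require Import complex reals.

Set Implicit Arguments.
Unset Strict Implicit.
Unset Printing Implicit Defensive.

Import Order.TTheory GRing.Theory Num.Theory.

Local Open Scope ring_scope.

Definition qform (K : fieldType) (A : 'M[K]_3) (x : 'rV[K]_3) : K :=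
  (x *m A *m x^T) 0 0.

Definition on_conic (K : fieldType) (A : 'M[K]_3) (x : 'rV[K]_3) : Prop :=
  x != 0 /\ qform A x = 0.

Definition regular_conic (K : fieldType) (A : 'M[K]_3) : Prop :=
  A^T = A /\ A \in unitmx.

Definition absolute_conic (K : fieldType) : 'M[K]_3 := 1%:M.

Definition on_line (K : fieldType) (x u : 'rV[K]_3) : Prop := x *m u^T = 0.

(* Line coordinates are conjugate with respect to the dual conic. *)
Definition conjugate_lines (K : fieldType) (A : 'M[K]_3) (u v : 'rV[K]_3) :
    Prop :=
  u *m invmx A *m v^T = 0.

Definition orthogonal_lines (K : fieldType) (u v : 'rV[K]_3) : Prop :=
  conjugate_lines (absolute_conic K) u v.

Definition right_angle (K : fieldType) (p q r : 'rV[K]_3) : Prop :=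
  exists u v : 'rV[K]_3,
    [/\ u != 0 /\ v != 0,
        on_line p u /\ on_line q u,
        on_line p v /\ on_line r v
      & orthogonal_lines u v].

Definition triangle (K : fieldType) (p q r : 'rV[K]_3) : Prop :=
  row_free (col_mx p (col_mx q r)).

Definition inscribed_right_triangle (K : fieldType) (C : 'M[K]_3)
    (p q r : 'rV[K]_3) : Prop :=
  [/\ on_conic C p, on_conic C q, on_conic C r, triangle p q r
    & right_angle p q r].

Definition on_all_hypotenuses (K : fieldType) (C : 'M[K]_3)
    (p f : 'rV[K]_3) : Prop :=
  f != 0 /\
  forall q r : 'rV[K]_3, inscribed_right_triangle C p q r -> (f <= q + r)%MS.

Definition fregier_point (K : fieldType) (C : 'M[K]_3) (p f : 'rV[K]_3) :
    Prop :=
  on_all_hypotenuses C p f /\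
  forall g : 'rV[K]_3, on_all_hypotenuses C p g -> (g == f)%MS.

Definition fregier_conic (K : fieldType) (C : 'M[K]_3) (f : 'rV[K]_3) : Prop :=
  exists p : 'rV[K]_3, on_conic C p /\ fregier_point C p f.

Definition fregier_conic_singular (K : fieldType) (C : 'M[K]_3) : Prop :=
  ~ exists F : 'M[K]_3,
      regular_conic F /\
      forall f : 'rV[K]_3, fregier_conic C f <-> on_conic F f.

(* The bijective quadratic parametrization of the absolute conic over an
   algebraically closed field by the points (s : t) of the projective line:
   (s^2 - t^2)^2 + (2 s t)^2 + i^2 (s^2 + t^2)^2 = 0. *)
Definition absolute_point (K : numClosedFieldType) (q : K * K) : 'rV[K]_3 :=
  \row_j [:: q.1 ^+ 2 - q.2 ^+ 2; 2 * q.1 * q.2;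
             'i * (q.1 ^+ 2 + q.2 ^+ 2)]`_j.

(* The base points of the pencil spanned by A and the absolute conic, with
   multiplicities: the parameters of the four intersection points are the zeros
   of the binary quartic form obtained by restricting A to the absolute conic. *)
Definition base_points (K : numClosedFieldType) (A : 'M[K]_3)
    (q : 4.-tuple (K * K)) : Prop :=
  (forall j, tnth q j != (0, 0)) /\
  exists2 c : K, c != 0 &
    forall s t : K,
      qform A (absolute_point (s, t)) =
      c * \prod_(j < 4) (s * (tnth q j).2 - t * (tnth q j).1).

Definition double_contact (K : numClosedFieldType) (A : 'M[K]_3) : Prop :=
  exists q1 q2 q3 q4 : K * K,
    [/\ base_points A [tuple q1; q2; q3; q4],
        (absolute_point q1 == absolute_point q2)%MS,
        (absolute_point q3 == absolute_point q4)%MS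
      & ~~ (absolute_point q1 == absolute_point q3)%MS].

Definition real_circle (R : realType) (A : 'M[R]_3) : Prop :=
  A^T = A /\ double_contact (map_mx (real_complex R) A).

(* The conic b^2 x1^2 + a^2 x2^2 = a^2 b^2 x0^2, that is,
   (x1 / a)^2 + (x2 / b)^2 = x0^2. *)
Definition conic_ab (K : fieldType) (a b : K) : 'M[K]_3 :=
  diag_mx (\row_j [:: - (a ^+ 2 * b ^+ 2); b ^+ 2; a ^+ 2]`_j).

(* Main.v *)
(* The Fregier map is linear.  Let p lie on the conic A and let p, u, v be
   orthogonal.  The lines joining p to u and to v meet A again in
   (u A u) p - 2 (p A u) u and (v A v) p - 2 (p A v) v.  Dividing by the squared
   norms of u and v and adding gives tr(A) p - 2 p A, which does not depend on u
   and v and hence is the Fregier point of p.  So the Fregier conic is the image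
   of A under M = tr(A) - 2 A.  For diagonal A it is singular iff an entry of M
   vanishes, and then it lies on a line.
   Restricting diag(d, e, f) to the parametrized absolute conic gives a binary
   quartic which is a square only if two of d, e, f agree; for the conic of the
   theorem this means a^2 = b^2. *)

Require Import Defs.
From mathcomp Require Import all_boot all_order all_algebra.
From mathcomp Require Import complex reals.
From mathcomp Require Import ring lra.

Set Implicit Arguments.
Unset Strict Implicit.
Unset Printing Implicit Defensive.

Import Order.TTheory GRing.Theory Num.Theory.
Local Open Scope ring_scope.

(** * Bilinear form of the absolute conic, and orthogonal triples *)

Definition dot (K : fieldType) (n : nat) (x y : 'rV[K]_n) : K :=
  (x *m y^T) 0 0.

Lemma dotC (K : fieldType) (n : nat) (x y : 'rV[K]_n) : dot x y = dot y x.
Proof. by rewrite /dot -[in LHS](trmxK x) -trmx_mul mxE. Qed.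

Lemma dotDl (K : fieldType) (n : nat) (x y z : 'rV[K]_n) :
  dot (x + y) z = dot x z + dot y z.
Proof. by rewrite /dot mulmxDl mxE. Qed.

Lemma dotZl (K : fieldType) (n : nat) (c : K) (x z : 'rV[K]_n) :
  dot (c *: x) z = c * dot x z.
Proof. by rewrite /dot -scalemxAl mxE. Qed.

Lemma dotDr (K : fieldType) (n : nat) (x y z : 'rV[K]_n) :
  dot z (x + y) = dot z x + dot z y.
Proof. by rewrite dotC dotDl !(dotC _ z). Qed.

Lemma dotZr (K : fieldType) (n : nat) (c : K) (x z : 'rV[K]_n) :
  dot z (c *: x) = c * dot z x.
Proof. by rewrite dotC dotZl dotC. Qed.

Definition dotE := (dotDl, dotDr, dotZl, dotZr).

Lemma dot_mulmx (K : fieldType) (n : nat) (A : 'M[K]_n) (x y : 'rV[K]_n) :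
  A^T = A -> dot (x *m A) y = dot (y *m A) x.
Proof. by move=> sA; rewrite dotC /dot trmx_mul sA mulmxA. Qed.

Lemma dot0P (K : fieldType) (n : nat) (x y : 'rV[K]_n) :
  x *m y^T = 0 <-> dot x y = 0.
Proof.
split=> [h|h]; first by rewrite /dot h mxE.
by apply/matrixP=> i j; rewrite !ord1 [RHS]mxE.
Qed.

Lemma dot_eq0 (K : realFieldType) (n : nat) (x : 'rV[K]_n) :
  (dot x x == 0) = (x == 0).
Proof.
apply/eqP/eqP=> [|->]; last by rewrite /dot mul0mx mxE.
rewrite /dot mxE => /eqP; rewrite psumr_eq0 => [/allP h|i _]; last first.
  by rewrite mxE -expr2 sqr_ge0.
apply/rowP=> i; rewrite mxE; apply/eqP.
by have := h i (mem_index_enum _); rewrite mxE -expr2 sqrf_eq0.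
Qed.

Lemma dot_gt0 (K : realFieldType) (n : nat) (x : 'rV[K]_n) :
  x != 0 -> 0 < dot x x.
Proof.
move=> x0; rewrite lt0r dot_eq0 x0 /dot mxE sumr_ge0 // => i _.
by rewrite mxE -expr2 sqr_ge0.
Qed.

(** With the [e i] as rows of [P], orthogonality exhibits a right inverse of [P]. For a square
    matrix it is also a left inverse, and the product in that order is the sum. *)
Lemma orthogonal_resolution (K : realFieldType) (n : nat)
    (e : 'I_n -> 'rV[K]_n) :
  (forall i, e i != 0) -> (forall i j, i != j -> dot (e i) (e j) = 0) ->
  1%:M = \sum_i (dot (e i) (e i))^-1 *: ((e i)^T *m e i).
Proof.
move=> e0 eo.
pose P := \matrix_i e i.
pose d := \row_i (dot (e i) (e i))^-1.
have : P *m (P^T *m diag_mx d) = 1%:M.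
  apply/matrixP=> i j; rewrite mulmxA mul_mx_diag !mxE.
  have -> : \sum_k P i k * P^T k j = dot (e i) (e j).
    by rewrite /dot mxE; apply: eq_bigr=> k _; rewrite !mxE.
  case: eqVneq => [<-|ne]; last by rewrite eo // mul0r.
  by rewrite mulfV // dot_eq0.
move/mulmx1C => <-; apply/matrixP=> i j.
rewrite mul_mx_diag mxE summxE; apply: eq_bigr=> k _.
by rewrite !mxE big_ord1 !mxE; ring.
Qed.

Section OrthogonalTriple.
Variables (K : realFieldType) (p u v : 'rV[K]_3).
Hypotheses (p0 : p != 0) (u0 : u != 0) (v0 : v != 0).
Hypotheses (pu : dot p u = 0) (pv : dot p v = 0) (uv : dot u v = 0).

Lemma orthogonal_triple_resolution :
  1%:M = (dot p p)^-1 *: (p^T *m p) + (dot u u)^-1 *: (u^T *m u)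
         + (dot v v)^-1 *: (v^T *m v).
Proof.
pose e (i : 'I_3) := [:: p; u; v]`_i.
rewrite (@orthogonal_resolution K 3 e).
- by rewrite !big_ord_recr big_ord0 /= add0r.
- by case=> [[|[|[|]]]].
- by case=> [[|[|[|]]]] // ? [[|[|[|]]]] //= ? _; rewrite /e //= dotC.
Qed.

Lemma orthogonal_triple_expansion (x : 'rV[K]_3) :
  x = (dot x p / dot p p) *: p + (dot x u / dot u u) *: u
      + (dot x v / dot v v) *: v.
Proof.
rewrite -[LHS]mulmx1 orthogonal_triple_resolution !mulmxDr.
by congr (_ + _ + _); rewrite -scalemxAr mulmxA [x *m _]mx11_scalar
  mul_scalar_mx scalerA mulrC.
Qed.

Lemma orthogonal_triple_trace (A : 'M[K]_3) :
  \tr A = dot (p *m A) p / dot p p + dot (u *m A) u / dot u u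
          + dot (v *m A) v / dot v v.
Proof.
have trE (x : 'rV[K]_3) : \tr ((dot x x)^-1 *: (x^T *m x) *m A)
    = dot (x *m A) x / dot x x.
  by rewrite -scalemxAl mxtraceZ -mulmxA mxtrace_mulC [_ *m _]mx11_scalar
    mxtrace_scalar mulr1n mulrC.
by rewrite -[in LHS](mul1mx A) orthogonal_triple_resolution !mulmxDl !mxtraceD
  !trE.
Qed.

End OrthogonalTriple.

Lemma exists_orthogonal (K : fieldType) (p u : 'rV[K]_3) :
  exists t : 'rV[K]_3, [/\ t != 0, dot p t = 0 & dot u t = 0].
Proof.
pose W := (col_mx p u)^T.
have kW : kermx W != 0.
  rewrite -mxrank_eq0 mxrank_ker -lt0n subn_gt0.
  exact: leq_ltn_trans (rank_leq_col _) _.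
have /rowV0Pn [t] := kW.
move=> /sub_kermxP tW t0; exists t; move: tW.
rewrite /W tr_col_mx mul_mx_row => /eqP; rewrite row_mx_eq0.
move=> /andP[/eqP tp /eqP tu]; split=> //; rewrite dotC; exact/dot0P.
Qed.

(** If the line spanned by [e] and [d] lay on the conic, [e *m A] and [d *m A] would both be
    orthogonal to [e] and [d], hence multiples of one vector [t], against the invertibility of
    [A]. *)
Lemma no_isotropic_line (K : realFieldType) (A : 'M[K]_3) (e d : 'rV[K]_3) :
  A^T = A -> A \in unitmx -> e != 0 -> d != 0 -> dot e d = 0 ->
  dot (e *m A) e = 0 -> dot (e *m A) d = 0 -> dot (d *m A) d != 0.
Proof.
move=> sA uA e0 d0 ed ee eAd; apply/eqP => dd.
have [t [t0 et dt]] := exists_orthogonal e d.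
have eE := orthogonal_triple_expansion e0 d0 t0 ed et dt (e *m A).
have dE := orthogonal_triple_expansion e0 d0 t0 ed et dt (d *m A).
have dAe : dot (d *m A) e = 0 by rewrite dot_mulmx.
rewrite ee eAd !mul0r !scale0r !add0r in eE.
rewrite dAe dd !mul0r !scale0r !add0r in dE.
set x := _ / _ in eE; set y := _ / _ in dE.
have y0 : y = 0.
  have : (y *: e - x *: d) *m A = 0.
    by rewrite mulmxBl -!scalemxAl eE dE !scalerA mulrC subrr.
  move/(congr1 (mulmx^~ (invmx A))); rewrite /= mulmxK // mul0mx.
  move/(congr1 (fun z => dot z e))/eqP; rewrite /= -scaleNr !dotE (dotC d) ed mulr0 addr0.
  rewrite {2}/dot mul0mx mxE mulf_eq0 dot_eq0 (negPf e0) orbF.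
  by move/eqP.
move: dE; rewrite y0 scale0r => /(congr1 (mulmx^~ (invmx A))).
by rewrite /= mulmxK // mul0mx => /eqP; rewrite (negPf d0).
Qed.

(** * The Frégier map and inscribed right triangles *)

Definition fregier_mx (K : fieldType) (A : 'M[K]_3) : 'M[K]_3 :=
  (\tr A)%:M - 2 *: A.

Lemma mul_fregier_mx (K : fieldType) (A : 'M[K]_3) (p : 'rV[K]_3) :
  p *m fregier_mx A = \tr A *: p - 2 *: (p *m A).
Proof. by rewrite mulmxBr mul_mx_scalar -scalemxAr. Qed.

Lemma triangleE (K : fieldType) (p q r : 'rV[K]_3) :
  triangle p q r <-> (1%:M <= p + (q + r))%MS.
Proof.
have -> : (1%:M <= p + (q + r))%MS = (1%:M <= col_mx p (col_mx q r))%MS.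
  apply/idP/idP=> h; apply: (submx_trans h).
    rewrite -addsmxE; apply: addsmxS => //; by rewrite addsmxE.
  rewrite -addsmxE; apply: addsmxS => //; by rewrite addsmxE.
by rewrite sub1mx.
Qed.

Lemma rank_row_adds (K : fieldType) (n : nat) (x y : 'rV[K]_n) :
  (\rank (x + y)%MS <= 2)%N.
Proof.
apply: leq_trans (mxrank_adds_leqif _ _) _.
by apply: (@leq_add _ _ 1 1); apply: rank_leq_row.
Qed.

Lemma triangle_notin_line (K : fieldType) (p q r : 'rV[K]_3) (c : K) :
  triangle p q r -> q != c *: p /\ r != c *: p.
Proof.
move/triangleE=> h.
have no (x : 'rV[K]_3) : ~~ (1%:M <= p + x)%MS.
  apply/negP=> /mxrankS; rewrite mxrank1 => /leq_trans /(_ (rank_row_adds _ _)).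
  by [].
split; apply/eqP => E.
  have /negP[] := no r; apply: (submx_trans h); rewrite E !addsmx_sub.
  by rewrite addsmxSl addsmxSr (submx_trans (scalemx_sub c (submx_refl p))) ?addsmxSl.
have /negP[] := no q; apply: (submx_trans h); rewrite E !addsmx_sub.
by rewrite addsmxSl addsmxSr (submx_trans (scalemx_sub c (submx_refl p))) ?addsmxSl.
Qed.

(* If x is orthogonal to p and p is on the conic A, this is the second
   intersection of A with the line joining p and x. *)
Definition chord_vector (K : fieldType) (A : 'M[K]_3) (p x : 'rV[K]_3) :
    'rV[K]_3 :=
  dot (x *m A) x *: p - (2 * dot (p *m A) x) *: x.

Lemma qform_chord_vector (K : fieldType) (A : 'M[K]_3) (p x : 'rV[K]_3) :
  A^T = A -> qform A p = 0 -> qform A (chord_vector A p x) = 0.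
Proof.
rewrite /qform -!/(dot _ _) => sA pp; rewrite /chord_vector -scaleNr.
rewrite mulmxDl -!scalemxAl !dotE pp (dot_mulmx x p sA); ring.
Qed.

(** As [p] is on the conic, the equation of [q] is divisible by [s] and becomes
    [s (x A x) = - 2 c (p A x)], so the chord vector is a multiple of [q]. It vanishes when
    [p A x = 0], whence an inclusion and not an equality. *)
Lemma chord_vector_sub (K : fieldType) (A : 'M[K]_3) (p x q : 'rV[K]_3)
    (c s : K) :
  A^T = A -> qform A p = 0 -> qform A q = 0 -> q = c *: p + s *: x ->
  s != 0 -> (chord_vector A p x <= q)%MS.
Proof.
rewrite /qform -!/(dot _ _) => sA pp qq qE s0.
move: qq; rewrite {1 2}qE mulmxDl -!scalemxAl !dotE pp (dot_mulmx x p sA) => qq.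
have {}qq : s * dot (x *m A) x = - (2 * c * dot (p *m A) x).
  by apply: (mulfI s0); apply/eqP; rewrite -subr_eq0 -[X in _ == X]qq; apply/eqP; ring.
suff -> : chord_vector A p x = (s^-1 * - (2 * dot (p *m A) x)) *: q.
  exact: scalemx_sub.
apply: (scalerI s0); rewrite [RHS]scalerA mulrA mulfV // mul1r qE.
rewrite /chord_vector scalerBr !scalerA qq scalerDr !scalerA.
by rewrite -scaleNr; congr (_ *: _ + _ *: _); ring.
Qed.

Lemma fregier_decomposition (K : realFieldType) (A : 'M[K]_3)
    (p u v : 'rV[K]_3) :
  p != 0 -> u != 0 -> v != 0 ->
  dot p u = 0 -> dot p v = 0 -> dot u v = 0 -> qform A p = 0 ->
  p *m fregier_mx A = (dot u u)^-1 *: chord_vector A p u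
                      + (dot v v)^-1 *: chord_vector A p v.
Proof.
move=> p0 u0 v0 pu pv uv pp.
have E := orthogonal_triple_expansion p0 u0 v0 pu pv uv (p *m A).
have {}pp : dot (p *m A) p = 0 by [].
rewrite mul_fregier_mx {1}E (orthogonal_triple_trace p0 u0 v0 pu pv uv) pp.
rewrite /chord_vector; apply/rowP=> j; rewrite !mxE; ring.
Qed.

Lemma fregier_mx_on_hypotenuse (K : realFieldType) (A : 'M[K]_3)
    (p q r : 'rV[K]_3) :
  A^T = A -> inscribed_right_triangle A p q r ->
  (p *m fregier_mx A <= q + r)%MS.
Proof.
move=> sA [[p0 pp] [q0 qq] [r0 rr] tr [u [v [[u0 v0]]]]].
rewrite /on_line /orthogonal_lines /conjugate_lines /absolute_conic.
rewrite invmx1 mulmx1 => -[/dot0P pu /dot0P qu] [/dot0P pv /dot0P rv] /dot0P uv.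
(* The line with coordinates [u] is spanned by [p] and [v], and vice versa: [q] lies on the chord
   towards [v], and [r] on the chord towards [u]. *)
have qE := orthogonal_triple_expansion p0 u0 v0 pu pv uv q.
have rE := orthogonal_triple_expansion p0 u0 v0 pu pv uv r.
rewrite qu mul0r scale0r addr0 in qE; rewrite rv mul0r scale0r addr0 in rE.
rewrite (fregier_decomposition p0 u0 v0) // addrC.
apply: addmx_sub_adds; apply: scalemx_sub.
  apply: (chord_vector_sub sA pp qq qE); apply/eqP => s0.
  have [/eqP[]] := triangle_notin_line (dot q p / dot p p) tr.
  by rewrite {1}qE s0 scale0r addr0.
apply: (chord_vector_sub sA pp rr rE); apply/eqP => s0.
have [_ /eqP[]] := triangle_notin_line (dot r p / dot p p) tr.
by rewrite {1}rE s0 scale0r addr0.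
Qed.

(** The last two hypotheses say that neither leg is tangent at [p]. Then [u] and [v] can be
    recovered from [p] and the chord vectors, so these three span the space. *)
Lemma chord_vectors_inscribed (K : realFieldType) (A : 'M[K]_3)
    (p u v : 'rV[K]_3) :
  A^T = A -> p != 0 -> u != 0 -> v != 0 ->
  dot p u = 0 -> dot p v = 0 -> dot u v = 0 -> qform A p = 0 ->
  dot (p *m A) u != 0 -> dot (p *m A) v != 0 ->
  inscribed_right_triangle A p (chord_vector A p v) (chord_vector A p u).
Proof.
move=> sA p0 u0 v0 pu pv uv pp pAu pAv.
have tri : triangle p (chord_vector A p v) (chord_vector A p u).
  apply/triangleE; set V := (p + _)%MS.
  have pV : (p <= V)%MS by exact: addsmxSl.
  have xV x : (chord_vector A p x <= V)%MS -> dot (p *m A) x != 0 -> (x <= V)%MS.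
    move=> cV h; have n0 : 2 * dot (p *m A) x != 0 by rewrite mulf_neq0 ?pnatr_eq0.
    rewrite -(scale1r x) -(mulVf n0) -scalerA scalemx_sub //.
    have -> : (2 * dot (p *m A) x) *: x = dot (x *m A) x *: p - chord_vector A p x.
      by rewrite opprB addrC subrK.
    by rewrite addmx_sub ?eqmx_opp // scalemx_sub.
  have uV : (u <= V)%MS.
    by apply: xV => //; apply: submx_trans (addsmxSr _ _); exact: addsmxSr.
  have vV : (v <= V)%MS.
    by apply: xV => //; apply: submx_trans (addsmxSr _ _); exact: addsmxSl.
  rewrite (orthogonal_triple_resolution p0 u0 v0 pu pv uv).
  by rewrite !addmx_sub // scalemx_sub // mulmx_sub.
have cn0 x : (forall c, chord_vector A p x != c *: p) -> chord_vector A p x != 0.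
  by move/(_ 0); rewrite scale0r.
split=> //.
- split; last exact: qform_chord_vector.
  by apply: cn0 => c; have [] := triangle_notin_line c tri.
- split; last exact: qform_chord_vector.
  by apply: cn0 => c; have [] := triangle_notin_line c tri.
exists u, v; rewrite /on_line /orthogonal_lines /conjugate_lines /absolute_conic.
rewrite invmx1 mulmx1 /chord_vector -!scaleNr.
split; [by [] | split | split |]; apply/dot0P => //; by rewrite !dotE ?(dotC v u) ?pu ?pv ?uv !mulr0 addr0.
Qed.

(** * Uniqueness of the Frégier point *)

(** Two right triangles at [p] with distinct hypotenuses suffice: both [g] and the image of [p] lie
    on the two lines, which share only one point. *)
Lemma fregier_mx_unique (K : realFieldType) (A : 'M[K]_3) (p g : 'rV[K]_3) :
  regular_conic A -> on_conic A p -> p *m fregier_mx A != 0 ->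
  on_all_hypotenuses A p g -> (g == p *m fregier_mx A)%MS.
Proof.
move=> [sA uA] [p0 pp] f0 [g0 gh].
(* [n] gives the coordinates of the tangent at [p], and [t] is a further point of this tangent. A
   regular conic contains no line, so [t] is off the conic. *)
set n := p *m A; have n0 : n != 0.
  by apply: contraNneq p0 => n0; rewrite -(mulmxK uA p) -/n n0 mul0mx.
have pn : dot p n = 0 by rewrite dotC.
have [t [t0 pt nt]] := exists_orthogonal p n.
have tAt := no_isotropic_line sA uA p0 t0 pt pp nt.
have nn := dot_gt0 n0; have tt := dot_gt0 t0.
(* Right angles at [p], turning with [y]: [u y] and [w y] are orthogonal to [p] and to each other.
   For nonzero [y] neither leg is tangent; the values 1 and 2 are used below. *)
pose u y := n + y *: t; pose w y := (y * dot t t) *: n - dot n n *: t.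
pose r y := chord_vector A p (u y); pose q y := chord_vector A p (w y).
have nu y : dot n (u y) = dot n n by rewrite !dotE nt mulr0 addr0.
have nw y : dot n (w y) = y * dot t t * dot n n.
  by rewrite /w -scaleNr !dotE nt mulr0 addr0.
have ins (y : K) : y != 0 -> inscribed_right_triangle A p (q y) (r y).
  move=> y0; have nu0 : dot n (u y) != 0 by rewrite nu gt_eqF.
  have nw0 : dot n (w y) != 0 by rewrite nw !mulf_neq0 // gt_eqF.
  apply: chord_vectors_inscribed => //.
  - by apply: contraNneq nu0 => ->; rewrite /dot trmx0 mulmx0 mxE.
  - by apply: contraNneq nw0 => ->; rewrite /dot trmx0 mulmx0 mxE.
  - by rewrite !dotE pn pt mulr0 addr0.
  - by rewrite /w -scaleNr !dotE pn pt !mulr0 addr0.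
  by rewrite /w -scaleNr !dotE nt (dotC t) nt; ring.
pose H y := (q y + r y)%MS; pose f := p *m fregier_mx A.
have fH (y : K) : y != 0 -> (f <= H y)%MS by move=> /ins/fregier_mx_on_hypotenuse; exact.
have gH (y : K) : y != 0 -> (g <= H y)%MS by move=> /ins/gh.
pose V := (H 1 + H 2)%MS.
have one0 : (1 : K) != 0 by exact: oner_neq0.
have two0 : (2 : K) != 0 by rewrite pnatr_eq0.
have fV : (f <= V)%MS by apply: submx_trans (fH _ one0) (addsmxSl _ _).
have rH y : (r y <= H y)%MS by exact: addsmxSr.
have r1V : (r 1 <= V)%MS by apply: submx_trans (rH _) (addsmxSl _ _).
have r2V : (r 2 <= V)%MS by apply: submx_trans (rH _) (addsmxSr _ _).
have rE y : r y = (dot (n *m A) n + 2 * y * dot (n *m A) t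
                   + y ^+ 2 * dot (t *m A) t) *: p - (2 * dot n n) *: u y.
  rewrite /r /chord_vector -/n nu; congr (_ *: _ - _).
  by rewrite /u mulmxDl -scalemxAl !dotE (dot_mulmx t n sA); ring.
have trE := orthogonal_triple_trace p0 n0 t0 pn pt nt A.
have fE : f = \tr A *: p - 2 *: n by exact: mul_fregier_mx.
(* The three points f, r 1, r 2 are not collinear, as eliminating n and t from
   them leaves a nonzero multiple of p. *)
have pV : (p <= V)%MS.
  pose k := dot (t *m A) t * (2 + dot n n / dot t t).
  have k0 : k != 0.
    by rewrite mulf_neq0 // gt_eqF // addr_gt0 // ?divr_gt0 // ltr0n.
  have : (k *: p <= V)%MS.
    have -> : k *: p = dot n n *: f + r 2 - 2 *: r 1.
      rewrite !rE fE /u trE -/n (dotC n) pn /k.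
      apply/rowP=> j; rewrite !mxE; field.
      by rewrite !gt_eqF ?dot_gt0.
    by apply: addmx_sub; [apply: addmx_sub => // | rewrite eqmx_opp];
      apply: scalemx_sub.
  by move/(scalemx_sub k^-1); rewrite scalerA mulVf // scale1r.
have nV : (n <= V)%MS.
  have -> : n = 2^-1 *: (\tr A *: p - f).
    by rewrite fE opprB addrC subrK scalerA mulVf // scale1r.
  by rewrite scalemx_sub // addmx_sub ?eqmx_opp // scalemx_sub.
have tV : (t <= V)%MS.
  have c0 : 2 * dot n n != 0 by rewrite mulf_neq0 // gt_eqF.
  have : ((2 * dot n n) *: t <= V)%MS.
    have -> : (2 * dot n n) *: t = (dot (n *m A) n + 2 * 1 * dot (n *m A) t
        + 1 ^+ 2 * dot (t *m A) t) *: p - (2 * dot n n) *: n - r 1.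
      by rewrite rE /u; apply/rowP=> j; rewrite !mxE; ring.
    by apply: addmx_sub; [apply: addmx_sub | rewrite eqmx_opp //];
      rewrite ?eqmx_opp; apply: scalemx_sub.
  by move/(scalemx_sub (2 * dot n n)^-1); rewrite scalerA mulVf // scale1r.
have V3 : \rank V = 3%N.
  apply/eqP; rewrite -[_ == _]/(row_full V) -sub1mx.
  rewrite (orthogonal_triple_resolution p0 n0 t0 pn pt nt).
  by rewrite !addmx_sub // scalemx_sub // mulmx_sub.
(* Dimension formula: the sum of the two hypotenuses has rank 3 and each has rank at most 2. *)
have cap1 : (\rank (H 1%R :&: H 2%R)%MS <= 1)%N.
  rewrite -(leq_add2l (\rank V)) mxrank_sum_cap V3.
  by apply: (@leq_add _ _ 2 2); apply: rank_row_adds.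
have eq_cap (x : 'rV[K]_3) : x != 0 -> (x <= H 1)%MS -> (x <= H 2)%MS ->
    (x == H 1 :&: H 2)%MS.
  move=> x0 x1 x2.
  have xs : (x <= H 1 :&: H 2)%MS by rewrite sub_capmx x1.
  by rewrite -(geq_leqif (mxrank_leqif_eq xs)) rank_rV x0.
have /eqmxP ge := eq_cap g g0 (gH _ one0) (gH _ two0).
have /eqmxP fe := eq_cap f f0 (fH _ one0) (fH _ two0).
by apply/eqmxP; apply: eqmx_trans ge (eqmx_sym fe).
Qed.

(** * The Frégier conic as a linear image of the conic *)

Lemma eqmx_rowP (K : fieldType) (n : nat) (x y : 'rV[K]_n) :
  y != 0 -> (x == y)%MS -> exists2 c, c != 0 & x = c *: y.
Proof.
move=> y0 /andP[/sub_rVP[c E] yx]; exists c => //.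
apply: contraNneq y0 => c0; move: yx; rewrite E c0 scale0r.
by move/submx0null ->.
Qed.

Lemma fregier_pointE (K : realFieldType) (A : 'M[K]_3) (p f : 'rV[K]_3) :
  regular_conic A -> on_conic A p -> p *m fregier_mx A != 0 ->
  fregier_point A p f <-> (f == p *m fregier_mx A)%MS.
Proof.
move=> rA Ap M0; have sA := rA.1.
have hyp (x : 'rV[K]_3) : x != 0 -> (x <= p *m fregier_mx A)%MS ->
    on_all_hypotenuses A p x.
  move=> x0 xs; split=> // q r /fregier_mx_on_hypotenuse h.
  exact: submx_trans xs (h sA).
split=> [[fh _]|fe]; first exact: fregier_mx_unique.
have f0 : f != 0.
  by apply: contraNneq M0 => f0; move: fe; rewrite f0 => /andP[_ /submx0null ->].
split; first by apply: hyp => //; case/andP: fe.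
move=> g /(fregier_mx_unique rA Ap M0)/eqmxP ge.
by apply/eqmxP; apply: eqmx_trans ge _; apply/eqmx_sym/eqmxP.
Qed.

Lemma qformZ (K : fieldType) (A : 'M[K]_3) (c : K) (x : 'rV[K]_3) :
  qform A (c *: x) = c ^+ 2 * qform A x.
Proof. by rewrite /qform -!/(dot _ _) -scalemxAl !dotE mulrA expr2. Qed.

Lemma on_conicZ (K : fieldType) (A : 'M[K]_3) (c : K) (x : 'rV[K]_3) :
  c != 0 -> on_conic A x -> on_conic A (c *: x).
Proof.
by move=> c0 [x0 Ax]; split; rewrite ?qformZ ?Ax ?mulr0 // scaler_eq0 negb_or c0.
Qed.

(** A Frégier point equals [p *m fregier_mx A] up to a factor only; the factor is absorbed into
    [p]. *)
Lemma fregier_conicE (K : realFieldType) (A : 'M[K]_3) (f : 'rV[K]_3) :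
  regular_conic A ->
  (forall p, on_conic A p -> p *m fregier_mx A != 0) ->
  fregier_conic A f <-> exists2 p, on_conic A p & f = p *m fregier_mx A.
Proof.
move=> rA M0; split=> [[p [Ap]]|[p Ap ->]].
  move/(fregier_pointE _ rA Ap (M0 p Ap))/(eqmx_rowP (M0 p Ap)) => -[c c0 ->].
  by exists (c *: p); [exact: on_conicZ | rewrite scalemxAl].
exists p; split=> //; apply/fregier_pointE => //; first exact: M0.
by apply/eqmxP.
Qed.

(** The image of [A] under an invertible symmetric [M] is the conic with matrix
    [invmx M *m A *m invmx M], which is again regular. *)
Lemma fregier_conic_regular (K : realFieldType) (A : 'M[K]_3) :
  regular_conic A -> fregier_mx A \in unitmx -> ~ fregier_conic_singular A.
Proof.
move=> rA uM; set M := fregier_mx A; have [sA uA] := rA.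
have sM : M^T = M by rewrite /M /fregier_mx linearB linearZ /= tr_scalar_mx sA.
have M0 (x : 'rV[K]_3) : (x *m M == 0) = (x == 0).
  by rewrite -(can_eq (mulmxK uM) x 0) mul0mx.
apply; exists (invmx M *m A *m invmx M); split.
  split; last by rewrite !unitmx_mul !unitmx_inv uM uA.
  by rewrite !trmx_mul trmx_inv sM sA mulmxA.
have qE x : qform (invmx M *m A *m invmx M) (x *m M) = qform A x.
  by rewrite /qform trmx_mul sM !mulmxA (mulmxK uM) -[_ *m invmx M *m M]mulmxA
    mulVmx // mulmx1.
move=> f; apply: (iff_trans (fregier_conicE f rA _)) => [p [p0 _]|].
  by rewrite M0.
split=> [[p [p0 pp] ->]|[f0 ff]]; first by split; rewrite ?M0 ?qE.
have fM : f = f *m invmx M *m M by rewrite mulmxKV.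
exists (f *m invmx M) => //; rewrite fM M0 in f0; rewrite fM qE in ff.
by split.
Qed.

(** Three zeros on the line spanned by [e] and [d] make the restricted quadratic form vanish, so the
    conic would contain that line. *)
Lemma three_collinear_points (K : realFieldType) (F : 'M[K]_3)
    (e d : 'rV[K]_3) :
  dot e d = 0 -> d != 0 ->
  on_conic F e -> on_conic F (e + d) -> on_conic F (e - d) ->
  ~ regular_conic F.
Proof.
move=> ed d0 [e0 ee] [_ p1] [_ p2] [sF uF].
move: ee p1 p2; rewrite /qform -!/(dot _ _) -(scaleN1r d).
rewrite !mulmxDl -!scalemxAl !dotE (dot_mulmx d e sF) => ee; rewrite ee => p1 p2.
have eFd : dot (e *m F) d = 0 by lra.
have dFd : dot (d *m F) d = 0 by lra.
by have /eqP := no_isotropic_line sF uF e0 d0 ed ee eFd.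
Qed.

(** * Diagonal conics in coordinates *)

(** The list has the same form as in [conic_ab] and [absolute_point], so both match [row3] by
    conversion. *)
Definition row3 (K : fieldType) (x y z : K) : 'rV[K]_3 :=
  \row_j [:: x; y; z]`_j.

Lemma row3E (K : fieldType) (x : 'rV[K]_3) : x = row3 (x 0 0) (x 0 1) (x 0 2).
Proof.
apply/rowP=> j; rewrite mxE; case: j => [[|[|[|]]]] //= i;
  by congr (x _ _); apply: val_inj.
Qed.

Lemma row3_eq0 (K : fieldType) (x y z : K) :
  (row3 x y z == 0) = [&& x == 0, y == 0 & z == 0].
Proof.
apply/eqP/and3P=> [/rowP E|[/eqP-> /eqP-> /eqP->]].
  by have := (E 0, E 1, E 2); rewrite !mxE /= => -[[-> ->] ->].
by apply/rowP=> j; rewrite !mxE; case: j => [[|[|[|]]]].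
Qed.

Lemma row3_diag (K : fieldType) (x y z d e f : K) :
  row3 x y z *m diag_mx (row3 d e f) = row3 (x * d) (y * e) (z * f).
Proof.
by apply/rowP=> j; rewrite mul_mx_diag !mxE; case: j => [[|[|[|]]]].
Qed.

Lemma dot_row3 (K : fieldType) (x y z d e f : K) :
  dot (row3 x y z) (row3 d e f) = x * d + y * e + z * f.
Proof. by rewrite /dot mxE !big_ord_recr big_ord0 /= !mxE /= add0r. Qed.

Lemma qform_diag (K : fieldType) (x y z d e f : K) :
  qform (diag_mx (row3 d e f)) (row3 x y z) = d * x ^+ 2 + e * y ^+ 2 + f * z ^+ 2.
Proof. by rewrite /qform -/(dot _ _) row3_diag dot_row3; ring. Qed.

Lemma diag_unit (K : fieldType) (d e f : K) :
  (diag_mx (row3 d e f) \in unitmx) = [&& d != 0, e != 0 & f != 0].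
Proof.
rewrite unitmxE det_diag !big_ord_recr big_ord0 /= !mxE /= mul1r unitfE.
by rewrite !mulf_eq0 !negb_or andbA.
Qed.

Lemma fregier_mx_diag (K : fieldType) (d e f : K) :
  fregier_mx (diag_mx (row3 d e f)) =
  diag_mx (row3 (e + f - d) (d + f - e) (d + e - f)).
Proof.
rewrite /fregier_mx mxtrace_diag !big_ord_recr big_ord0 /= !mxE /= add0r.
apply/matrixP=> i j; rewrite !mxE; case: eqVneq => [_|_]; last first.
  by rewrite !mulr0n mulr0 subr0.
by rewrite !mulr1n; case: i => [[|[|[|]]]] //= _; ring.
Qed.

(** * Degeneration of the Frégier map for [conic_ab] *)

Section Ellipse.
Variables (K : realFieldType) (a b : K).
Hypotheses (a0 : a != 0) (b0 : b != 0).
Let C := conic_ab a b.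

Let a2_gt0 : 0 < a ^+ 2. Proof. by rewrite exprn_even_gt0. Qed.
Let b2_gt0 : 0 < b ^+ 2. Proof. by rewrite exprn_even_gt0. Qed.
Let ab_gt0 : 0 < a ^+ 2 * b ^+ 2. Proof. exact: mulr_gt0. Qed.

Lemma conic_ab_regular : regular_conic C.
Proof.
split; first exact: tr_diag_mx.
by rewrite diag_unit oppr_eq0 mulf_neq0 ?expf_neq0.
Qed.

(** The equations [m1 = 0], [m2 = 0] and [m0 = 0] are, in this order, the three equations of the
    theorem with denominators cleared. *)
Let m0 := b ^+ 2 + a ^+ 2 + a ^+ 2 * b ^+ 2.
Let m1 := a ^+ 2 - b ^+ 2 - a ^+ 2 * b ^+ 2.
Let m2 := b ^+ 2 - a ^+ 2 - a ^+ 2 * b ^+ 2.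

Lemma fregier_mx_conic_ab : fregier_mx C = diag_mx (row3 m0 m1 m2).
Proof.
rewrite /C fregier_mx_diag; congr (diag_mx (row3 _ _ _)); rewrite /m0 /m1 /m2; ring.
Qed.

Let m0_neq0 : m0 != 0. Proof. by rewrite gt_eqF // !addr_gt0. Qed.

(** The form [b^2 y^2 + a^2 z^2] is definite. As [m0] is nonzero, the Frégier map then kills no
    point of the conic, even when its matrix is singular. *)
Lemma on_conic_ab_coord0 (x y z : K) : on_conic C (row3 x y z) -> x != 0.
Proof.
case=> p0; rewrite qform_diag => pp; apply: contraNneq p0 => x0.
move: pp; rewrite x0 expr0n /= mulr0 add0r => /eqP.
rewrite paddr_eq0 ?(mulr_ge0 (sqr_ge0 _) (sqr_ge0 _)) //.
rewrite !mulf_eq0 (negPf a0) (negPf b0) /= !orbb.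
by rewrite row3_eq0 eqxx.
Qed.

Lemma fregier_conic_abE (f : 'rV[K]_3) :
  fregier_conic C f <-> exists2 p, on_conic C p & f = p *m fregier_mx C.
Proof.
apply: fregier_conicE => [|p]; first exact: conic_ab_regular.
rewrite (row3E p) => /on_conic_ab_coord0 x0.
by rewrite fregier_mx_conic_ab row3_diag row3_eq0 mulf_eq0 (negPf x0) (negPf m0_neq0).
Qed.

Lemma fregier_conic_ab_row3 (x y z : K) : x != 0 ->
  b ^+ 2 * y ^+ 2 + a ^+ 2 * z ^+ 2 = a ^+ 2 * b ^+ 2 * x ^+ 2 ->
  fregier_conic C (row3 (x * m0) (y * m1) (z * m2)).
Proof.
move=> x0 E; apply/fregier_conic_abE; exists (row3 x y z); last first.
  by rewrite fregier_mx_conic_ab row3_diag.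
split; first by rewrite row3_eq0 (negPf x0).
by rewrite qform_diag -addrA E; ring.
Qed.

Lemma fregier_conic_ab_singularE :
  fregier_conic_singular C <-> m1 = 0 \/ m2 = 0.
Proof.
split=> [sing|m12 [F [rF FE]]].
  case: (eqVneq m1 0) => [|m1n]; first by left.
  case: (eqVneq m2 0) => [|m2n]; first by right.
  case: (fregier_conic_regular conic_ab_regular _ sing).
  by rewrite fregier_mx_conic_ab diag_unit m0_neq0 m1n.
have addE (x y z d e f : K) :
    row3 x y z + row3 d e f = row3 (x + d) (y + e) (z + f).
  by apply/rowP=> j; rewrite !mxE; case: j => [[|[|[|]]]].
have oppE (x y z : K) : - row3 x y z = row3 (- x) (- y) (- z).
  by apply/rowP=> j; rewrite !mxE; case: j => [[|[|[|]]]].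
have onF y z : b ^+ 2 * y ^+ 2 + a ^+ 2 * z ^+ 2 = a ^+ 2 * b ^+ 2 ->
    on_conic F (row3 m0 (y * m1) (z * m2)).
  move=> E; apply/FE; rewrite -[m0]mul1r; apply: fregier_conic_ab_row3 => //.
    exact: oner_neq0.
  by rewrite E expr1n mulr1.
(* Images of the vertices [(1, a, 0)], [(1, -a, 0)], [(1, 0, b)], [(1, 0, -b)]. If [m1 = 0], the
   first two share the image [e] and the others go to [e + d] and [e - d]; if [m2 = 0], the pairs
   swap roles. *)
have pa := onF a 0; have na := onF (- a) 0.
have pb := onF 0 b; have nb := onF 0 (- b).
case: m12 => mz.
(* Both cannot vanish, since [m1 + m2 = - 2 a^2 b^2]. *)
- have m2n : m2 != 0 by apply/eqP; move: mz ab_gt0; rewrite /m1 /m2 => ? ? ?; lra.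
  apply: (@three_collinear_points _ F (row3 m0 0 0) (row3 0 0 (b * m2))) => //.
  + by rewrite dot_row3; ring.
  + by rewrite row3_eq0 eqxx mulf_neq0.
  + by move: pa; rewrite mz mulr0 mul0r; apply; ring.
  + by move: pb; rewrite addE mul0r addr0 !add0r; apply; ring.
  + move: nb; rewrite oppE addE mul0r mulNr !oppr0 !addr0 !add0r; apply; ring.
have m1n : m1 != 0 by apply/eqP; move: mz ab_gt0; rewrite /m1 /m2 => ? ? ?; lra.
apply: (@three_collinear_points _ F (row3 m0 0 0) (row3 0 (a * m1) 0)) => //.
- by rewrite dot_row3; ring.
- by rewrite row3_eq0 mulf_eq0 (negPf a0) (negPf m1n) /= andbF.
- by move: pb; rewrite mz mulr0 mul0r; apply; ring.
- by move: pa; rewrite addE mul0r !addr0 !add0r; apply; ring.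
- move: na; rewrite oppE addE mul0r mulNr !oppr0 !addr0 !add0r; apply; ring.
Qed.

End Ellipse.

(** * Double contact with the absolute conic, and circles *)

(** The coordinates determine [s^2], [s t] and [t^2] up to a common factor, which makes the square
    of the determinant of the two parameter pairs vanish. *)
Lemma absolute_point_eqmx (K : numClosedFieldType) (q r : K * K) :
  r != (0, 0) -> (absolute_point q == absolute_point r)%MS ->
  q.1 * r.2 = q.2 * r.1.
Proof.
move=> r0 /andP[/sub_rVP[c /rowP E] _].
have := (E 0, E 1, E 2); rewrite !mxE /= => -[[E0 E1] E2].
have i0 : ('i : K) != 0 by exact: neq0Ci.
have {}E2 : q.1 ^+ 2 + q.2 ^+ 2 = c * (r.1 ^+ 2 + r.2 ^+ 2).
  by apply: (mulfI i0); rewrite E2; ring.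
have two0 : (2 : K) != 0 by rewrite pnatr_eq0.
have Es : q.1 ^+ 2 = c * r.1 ^+ 2.
  apply: (mulfI two0).
  have -> : 2 * q.1 ^+ 2 = (q.1 ^+ 2 - q.2 ^+ 2) + (q.1 ^+ 2 + q.2 ^+ 2) by ring.
  by rewrite E0 E2; ring.
have Et : q.2 ^+ 2 = c * r.2 ^+ 2.
  apply: (mulfI two0).
  have -> : 2 * q.2 ^+ 2 = (q.1 ^+ 2 + q.2 ^+ 2) - (q.1 ^+ 2 - q.2 ^+ 2) by ring.
  by rewrite E0 E2; ring.
have Em : q.1 * q.2 = c * (r.1 * r.2).
  by apply: (mulfI two0); rewrite mulrA E1; ring.
apply/eqP; rewrite -subr_eq0 -sqrf_eq0.
have -> : (q.1 * r.2 - q.2 * r.1) ^+ 2 =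
   q.1 ^+ 2 * r.2 ^+ 2 - 2 * (q.1 * q.2) * r.1 * r.2 + q.2 ^+ 2 * r.1 ^+ 2 by ring.
by rewrite Es Et Em; apply/eqP; ring.
Qed.

Lemma pair_proportional (K : fieldType) (q r : K * K) :
  q != (0, 0) -> q.1 * r.2 = q.2 * r.1 ->
  exists c, r.1 = c * q.1 /\ r.2 = c * q.2.
Proof.
case: q r => [s t] [s' t'] /= q0 E.
case: (eqVneq s 0) => [s0|s0].
  have t0 : t != 0 by apply: contraNneq q0 => ->; rewrite s0.
  exists (t' / t); rewrite divfK //; split=> //.
  apply: (mulfI t0); rewrite -E s0; ring.
exists (s' / s); rewrite divfK //; split=> //.
apply: (mulfI s0); rewrite E; field; exact: s0.
Qed.

(* In the parameters (s : t) of the absolute conic the form is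
   (d - f) s^4 + (4 e - 2 d - 2 f) s^2 t^2 + (d - f) t^4; double contact makes it
   a multiple of a square. *)
Lemma double_contact_diag (K : numClosedFieldType) (d e f : K) :
  double_contact (diag_mx (row3 d e f)) ->
  [\/ d = f, d = e | e = f].
Proof.
case=> q1 [q2 [q3 [q4 [[q0 [c c0 base]] q12 q34 _]]]].
have q10 := q0 0; have q20 := q0 1; have q30 := q0 2; have q40 := q0 3.
rewrite /tnth /= in q10 q20 q30 q40.
have [l [l1 l2]] := pair_proportional q10 (absolute_point_eqmx q20 q12).
have [k [k1 k2]] := pair_proportional q30 (absolute_point_eqmx q40 q34).
(* With [q2 = l q1] and [q4 = k q3] the four linear factors pair up into [g] times the square of
   [A s^2 + B s t + D t^2]. *)
pose g := c * l * k.
pose A := q1.2 * q3.2; pose B := - (q1.2 * q3.1 + q1.1 * q3.2).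
pose D := q1.1 * q3.1.
have sq s t : (d - f) * s ^+ 4 + (4 * e - 2 * d - 2 * f) * (s ^+ 2 * t ^+ 2)
    + (d - f) * t ^+ 4 = g * (A * s ^+ 2 + B * (s * t) + D * t ^+ 2) ^+ 2.
  move: (base s t); rewrite !big_ord_recr big_ord0 /= !(tnth_nth (0, 0)) /=.
  rewrite [absolute_point _](_ : _ = row3 (s ^+ 2 - t ^+ 2) (2 * s * t)
    ('i * (s ^+ 2 + t ^+ 2))) // qform_diag [('i * _) ^+ 2]exprMn sqrCi l1 l2 k1 k2.
  rewrite /g /A /B /D => E; transitivity (d * (s ^+ 2 - t ^+ 2) ^+ 2 +
    e * (2 * s * t) ^+ 2 + f * (-1 * (s ^+ 2 + t ^+ 2) ^+ 2)); first ring.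
  by rewrite E; ring.
clearbody g A B D.
(* Evaluation at six points replaces comparing coefficients. The left side is even in [t], so the
   differences at [t = 1, -1] and at [t = 2, -2] isolate the terms with [B]. *)
have e10 := sq 1 0; have e01 := sq 0 1; have e11 := sq 1 1.
have e1n := sq 1 (-1); have e12 := sq 1 2; have e1m := sq 1 (-2).
case: (eqVneq d f) => [|df]; first by constructor 1.
have n0 n : (n.+1%:R : K) != 0 by rewrite pnatr_eq0.
have z1 : g * B * (A + D) = 0.
  apply: (mulfI (n0 3)); rewrite mulr0.
  have -> : 4 * (g * B * (A + D)) = g * (A * 1 ^+ 2 + B * (1 * 1) + D * 1 ^+ 2) ^+ 2
     - g * (A * 1 ^+ 2 + B * (1 * -1) + D * (-1) ^+ 2) ^+ 2 by ring.
  by rewrite -e11 -e1n; ring.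
have z2 : g * B * (A + 4 * D) = 0.
  apply: (mulfI (n0 7)); rewrite mulr0.
  have -> : 8 * (g * B * (A + 4 * D)) =
     g * (A * 1 ^+ 2 + B * (1 * 2) + D * 2 ^+ 2) ^+ 2
     - g * (A * 1 ^+ 2 + B * (1 * -2) + D * (-2) ^+ 2) ^+ 2 by ring.
  by rewrite -e12 -e1m; ring.
have gA : d - f = g * A ^+ 2.
  by transitivity (g * (A * 1 ^+ 2 + B * (1 * 0) + D * 0 ^+ 2) ^+ 2);
    [rewrite -e10; ring | ring].
have gD : d - f = g * D ^+ 2.
  by transitivity (g * (A * 0 ^+ 2 + B * (0 * 1) + D * 1 ^+ 2) ^+ 2);
    [rewrite -e01; ring | ring].
have df0 : d - f != 0 by rewrite subr_eq0.
have g0 : g != 0 by apply: contraNneq df0 => g0; rewrite gA g0 mul0r.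
have D0 : D != 0 by apply: contraNneq df0 => D0; rewrite gD D0 expr0n mulr0.
have B0 : B = 0.
  have : g * B * (3 * D) = 0.
    by rewrite -[RHS](subrr 0) -{1}z2 -z1; ring.
  move/eqP; rewrite !mulf_eq0 (negPf g0) (negPf D0) pnatr_eq0 /= !orbF.
  by move/eqP.
have e4 : 4 * (e - f) = g * (A + D) ^+ 2.
  transitivity (g * (A * 1 ^+ 2 + B * (1 * 1) + D * 1 ^+ 2) ^+ 2).
    by rewrite -e11; ring.
  by rewrite B0; ring.
(* The equal outer coefficients give [A^2 = D^2]. In [e4], [A = D] then yields [d = e], and
   [A = - D] yields [e = f]. *)
have : (A - D) * (A + D) = 0.
  apply: (mulfI g0); rewrite mulr0.
  by rewrite -[RHS](subrr (d - f)) {1}gA gD; ring.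
move/eqP; rewrite mulf_eq0 => /orP[]/eqP AD.
  constructor 2; apply/eqP; rewrite -subr_eq0; apply/eqP; apply: (mulfI (n0 3)).
  have -> : 4 * (d - e) = 4 * (d - f) - 4 * (e - f) by ring.
  by rewrite e4 gD (subr0_eq AD); ring.
constructor 3; apply/eqP; rewrite -subr_eq0; apply/eqP; apply: (mulfI (n0 3)).
by rewrite e4 AD; ring.
Qed.

(** The first diagonal entry is negative and the other two are positive, so only the latter can
    agree. *)
Lemma real_circle_conic_ab (R : realType) (a b : R) :
  a != 0 -> b != 0 -> real_circle (conic_ab a b) -> a ^+ 2 = b ^+ 2.
Proof.
move=> a0 b0 [_]; rewrite /conic_ab map_diag_mx.
have a2 : 0 < a ^+ 2 by rewrite exprn_even_gt0.
have b2 : 0 < b ^+ 2 by rewrite exprn_even_gt0.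
have ab2 := mulr_gt0 a2 b2.
rewrite (_ : map_mx _ _ = row3 (real_complex R (- (a ^+ 2 * b ^+ 2)))
  (real_complex R (b ^+ 2)) (real_complex R (a ^+ 2))); last first.
  by apply/rowP=> j; rewrite !mxE; case: j => [[|[|[|]]]].
by case/double_contact_diag => /fmorph_inj E; lra.
Qed.

(** * The equations in [a] and [b] *)

Theorem mainTheorem10 (R : realType) (a b : R) (ha : a != 0) (hb : b != 0) :
  [/\ fregier_conic_singular (conic_ab a b) <->
        [\/ b ^+ 2 = a ^+ 2 / (a ^+ 2 + 1),
            b ^+ 2 = - a ^+ 2 / (a ^+ 2 - 1)
          | b ^+ 2 = - (a ^+ 2 / (a ^+ 2 + 1))],
      b ^+ 2 <> - (a ^+ 2 / (a ^+ 2 + 1))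
    & [\/ b ^+ 2 = a ^+ 2 / (a ^+ 2 + 1),
          b ^+ 2 = - a ^+ 2 / (a ^+ 2 - 1)
        | b ^+ 2 = - (a ^+ 2 / (a ^+ 2 + 1))] ->
      ~ real_circle (conic_ab a b)].
Proof.
have a2 : 0 < a ^+ 2 by rewrite exprn_even_gt0.
have b2 : 0 < b ^+ 2 by rewrite exprn_even_gt0.
have a21 : a ^+ 2 + 1 != 0 by rewrite gt_eqF ?addr_gt0.
have case3 : b ^+ 2 <> - (a ^+ 2 / (a ^+ 2 + 1)).
  have : 0 < a ^+ 2 / (a ^+ 2 + 1) by rewrite divr_gt0 ?addr_gt0.
  by move=> h E; lra.
have case1 : b ^+ 2 = a ^+ 2 / (a ^+ 2 + 1) <->
    a ^+ 2 - b ^+ 2 - a ^+ 2 * b ^+ 2 = 0.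
  split=> [->|E]; first by field.
  by apply: (mulIf a21); rewrite divfK //; lra.
have case2 : b ^+ 2 = - a ^+ 2 / (a ^+ 2 - 1) <->
    b ^+ 2 - a ^+ 2 - a ^+ 2 * b ^+ 2 = 0.
  (* For [a^2 = 1] the quotient is 0 by the convention on division by zero, and both sides are
     false: one reads [b^2 = 0], the other [-1 = 0]. *)
  have [E1|a1] := eqVneq (a ^+ 2 - 1) 0.
    rewrite E1 invr0 mulr0; split=> E; first by lra.
    have {}E1 : a ^+ 2 = 1 by lra.
    by rewrite E1 in E; lra.
  split=> [->|E]; first by field.
  by apply: (mulIf a1); rewrite divfK //; lra.
split=> //.
  rewrite fregier_conic_ab_singularE // -case1 -case2.
  by split=> [[]|[]]; [constructor 1 | constructor 2 | left | right | move/case3].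
move=> fam circ; have ab := real_circle_conic_ab ha hb circ.
(* For [a^2 = b^2] each of the first two equations reduces to [- a^4 = 0]. *)
have aa := mulr_gt0 a2 a2.
by case: fam => [/case1|/case2|/case3 //]; rewrite -ab => E; lra.
Qed.
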